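(* Let $\mathfrak g$ be a stratified Lie algebra of step $2$, and let $k\ge 0$ be an integer. Then $\mathfrak g$ is hypergenerated of order $k$ if and only if $2k<\mathrm{order}(\mathfrak g)$.
   Context: A stratified Lie algebra of step $2$ is a finite-dimensional real Lie algebra with a decomposition $\mathfrak g=V_1\oplus V_2$ with $[V_1,V_1]=V_2\ne\{0\}$ and $[V_1,V_2]=\{0\}$, $[V_2,V_2]=\{0\}$; its rank is $m=\dim V_1$. It is hypergenerated of order $k$ if every linear subspace $P\subseteq V_1$ with $\dim P=m-k$ satisfies $[\mathfrak g,\mathfrak g]\subseteq\mathrm{Lie}(P)$, where $\mathrm{Lie}(P)$ is the smallest Lie subalgebra of $\mathfrak g$ containing $P$. The Kaplan operator is the linear map $\mathbf J:V_2^*\to\mathrm{Skew}(V_1)$ into the skew-symmetric bilinear forms on $V_1$ given by $\mathbf J_\mu(v,w)=\mu([v,w])$. The rank of a skew-symmetric bilinear form $\omega$ on a vector space $V$ is $\dim V-\dim\ker\omega$, where $\ker\omega=\{v\in V:\omega(v,w)=0\ \text{for every } w\in V\}$. The Métivier order of $\mathfrak g$ is $\mathrm{order}(\mathfrak g)=\min\{\mathrm{rank}(\mathbf J_\mu):\mu\in V_2^*\setminus\{0\}\}$.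
   Formalization: For k > m no subspace has dimension m-k, so ''hypergenerated of order k'' would hold vacuously and the equivalence would fail; here dim P = max(m-k, 0) is used, so that P = 0 is tested when k > m. *)

(* Defs.v *)
From HB Require Import structures.
From mathcomp Require Import all_boot all_order all_algebra.
From mathcomp Require Import boolp classical_sets reals.

Set Implicit Arguments.
Unset Strict Implicit.
Unset Printing Implicit Defensive.

Import GRing.Theory.
Local Open Scope ring_scope.

HB.mixin Record isLieAlgebra (K : fieldType) g of Vector K g := {
  bracket : g -> g -> g;
  bracket_bilinear : bilinear_for
    (GRing.Scale.Law.clone _ _ *:%R _) (GRing.Scale.Law.clone _ _ *:%R _)
    bracket;
  bracketvv : forall x, bracket x x = 0;
  bracket_jacobi : forall x y z,
    bracket x (bracket y z) + bracket y (bracket z x)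
      + bracket z (bracket x y) = 0
}.

#[short(type="lieAlgType")]
HB.structure Definition LieAlgebra (K : fieldType) :=
  {g of isLieAlgebra K g & Vector K g}.

HB.instance Definition _ (K : fieldType) (g : lieAlgType K) :=
  bilinear_isBilinear.Build K g g g _ _ (@bracket K g)
    (@bracket_bilinear K g).

Section LieAlgebraTheory.
Variables (K : fieldType) (g : lieAlgType K).
Implicit Types (x y : g) (U V W P L : {vspace g}).

Lemma bracketC x y : bracket x y = - bracket y x.
Proof.
apply/eqP; rewrite -addr_eq0; apply/eqP.
have := bracketvv (x + y).
by rewrite linearDl /= !linearDr /= !bracketvv add0r addr0.
Qed.

(* [U, V], the linear span of the brackets [x, y] with x in U and y in V; by
   bilinearity a basis of each side suffices, see memv_bracket and bracketsvP *)
Definition bracketsv U V : {vspace g} :=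
  <<allpairs bracket (vbasis U) (vbasis V)>>%VS.

Lemma memv_bracket U V : {in U & V, forall x y, bracket x y \in bracketsv U V}.
Proof.
move=> x y /coord_vbasis-> /coord_vbasis->.
rewrite linear_sumlz; apply: memv_suml => i _ /=.
rewrite linear_sumr; apply: memv_suml => j _ /=.
rewrite linearZl_LR linearZr_LR /= !memvZ // memv_span //.
by apply: allpairs_f; rewrite mem_nth ?size_tuple.
Qed.

Lemma bracketsvP U V W :
  reflect {in U & V, forall x y, bracket x y \in W} (bracketsv U V <= W)%VS.
Proof.
apply: (iffP idP) => [sUVW x y Ux Vy | sUVW].
  by rewrite (subvP sUVW) ?memv_bracket.
apply/span_subvP=> _ /allpairsP[[x y] /= [Ux Vy ->]].
by rewrite sUVW ?vbasis_mem.
Qed.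

Definition lie_subalgebra L : bool := (bracketsv L L <= L)%VS.

Definition lie_hull P : set g :=
  \bigcap_(L in [set L : {vspace g} | lie_subalgebra L /\ (P <= L)%VS]%classic)
    [set x | x \in L]%classic.

Record step2_stratification := Step2Stratification {
  layer1 : {vspace g};
  layer2 : {vspace g};
  layers_direct : directv (layer1 + layer2);
  layers_full : (layer1 + layer2)%VS = fullv;
  bracket_layer11 : bracketsv layer1 layer1 = layer2;
  layer2_neq0 : layer2 != 0%VS;
  bracket_layer12 : bracketsv layer1 layer2 = 0%VS;
  bracket_layer22 : bracketsv layer2 layer2 = 0%VS
}.

(* For k > \dim layer1 there are no subspaces of dimension \dim layer1 - k in
   the strict sense.  The truncated subtraction makes P = 0 the only one to
   test, so that the property fails for such k instead of holding vacuously. *)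
Definition hypergenerated (S : step2_stratification) (k : nat) : Prop :=
  forall P, (P <= layer1 S)%VS -> \dim P = (\dim (layer1 S) - k)%N ->
    ([set x | x \in bracketsv fullv fullv] `<=` lie_hull P)%classic.

Section Kaplan.
Variable S : step2_stratification.
Local Notation V1 := (subvs_of (layer1 S)).
Local Notation V2 := (subvs_of (layer2 S)).

(* vsproj only retypes the bracket, see bracket_layer2 *)
Definition kaplan (mu : 'Hom(V2, K^o)) (v w : V1) : K :=
  mu (vsproj (layer2 S) (bracket (vsval v) (vsval w))).

Lemma bracket_layer2 (v w : V1) :
  vsval (vsproj (layer2 S) (bracket (vsval v) (vsval w)))
  = bracket (vsval v) (vsval w).
Proof. by rewrite vsprojK // -bracket_layer11 memv_bracket ?subvsP. Qed.

Lemma kaplan_linear (a : K) (mu nu : 'Hom(V2, K^o)) (v w : V1) :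
  kaplan (a *: mu + nu) v w = a * kaplan mu v w + kaplan nu v w.
Proof. by rewrite /kaplan add_lfunE scale_lfunE. Qed.

Section Form.
Variable mu : 'Hom(V2, K^o).

Fact kaplan_bilinear : bilinear_for
  (GRing.Scale.Law.clone _ _ *%R _) (GRing.Scale.Law.clone _ _ (idfun \; *%R) _)
  (kaplan mu).
Proof.
split=> [w|v] a x y; rewrite /kaplan /=.
  by rewrite linearDl linearZl_LR /= !linearD !linearZ.
by rewrite linearDr linearZr_LR /= !linearD !linearZ.
Qed.

Fact kaplan_skew (v w : V1) :
  kaplan mu v w = (-1) ^+ true * idfun (kaplan mu w v).
Proof. by rewrite /kaplan bracketC !linearN /= mulN1r. Qed.

HB.instance Definition _ :=
  bilinear_isBilinear.Build K V1 V1 K _ _ (kaplan mu) kaplan_bilinear.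
HB.instance Definition _ :=
  isHermitianSesquilinear.Build K V1 true idfun (kaplan mu) kaplan_skew.

End Form.
End Kaplan.
End LieAlgebraTheory.

(* orthov omega fullv is the kernel of omega, by mem_orthovP *)
Definition form_rank (K : fieldType) (V : vectType K)
    (omega : {skew_symmetric V}) : nat :=
  (\dim {:V} - \dim (orthov omega fullv))%N.

Section MetivierOrder.
Variables (K : fieldType) (g : lieAlgType K) (S : step2_stratification g).

Definition is_kaplan_rank : pred nat := fun r =>
  `[< exists2 mu : 'Hom(subvs_of (layer2 S), K^o),
        mu != 0 & form_rank (kaplan mu) = r >].

Fact is_kaplan_rank_ex : exists r, is_kaplan_rank r.
Proof.
suff [mu mu0] : exists mu : 'Hom(subvs_of (layer2 S), K^o), mu != 0.
  by exists (form_rank (kaplan mu)); apply/asboolP; exists mu.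
have d0 : (0 < \dim (fullv : {vspace subvs_of (layer2 S)}))%N.
  by rewrite dimvf /dim /= lt0n dimv_eq0 layer2_neq0.
pose i0 := Ordinal d0.
exists (linfun (coord (vbasis fullv) i0 : _ -> K^o)).
apply/eqP => /lfunP /(_ (vbasis fullv)`_i0).
rewrite !lfunE [LHS](coord_free i0 i0 (basis_free (vbasisP fullv))) eqxx.
by move/eqP; rewrite oner_eq0.
Qed.

Definition metivier_order : nat := ex_minn is_kaplan_rank_ex.

End MetivierOrder.

(* Main.v *)
(** If [W] and [U] are subspaces of a space with a skew-symmetric form, then
    [\dim (U :&: W^perp) + \dim W = \dim U + \dim (W :&: U^perp)].  Hence an
    isotropic subspace has codimension at least half the rank of the form, and a
    maximal isotropic subspace of an alternating form (one equal to its own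
    orthogonal) has exactly that codimension.  On the other hand, for [P] in the
    first layer, [Lie(P) = P + [P, P]] misses a part of the second layer iff some
    nonzero functional [mu] vanishes on [P, P], i.e. iff [P] is isotropic for
    some [J_mu] with [mu] nonzero. *)
Require Import Defs.
From mathcomp Require Import all_boot all_order all_algebra.
From mathcomp Require Import boolp classical_sets reals zify.

Set Implicit Arguments.
Unset Strict Implicit.
Unset Printing Implicit Defensive.

Import GRing.Theory.
Local Open Scope ring_scope.

(** * Dimensions, functionals, and subspaces as spaces of their own *)

Section Subspaces.
Variables (K : fieldType) (vT : vectType K).
Implicit Types U W : {vspace vT}.

Lemma subv_dim_ex U n : (n <= \dim U)%N ->
  exists2 W, (W <= U)%VS & \dim W = n.
Proof.
move=> leU; exists <<take n (vbasis U)>>%VS.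
  by apply/span_subvP => x /mem_take; apply: vbasis_mem.
have := basis_free (vbasisP U).
rewrite -{1}(cat_take_drop n (vbasis U)) => /catl_free /eqP->.
by rewrite size_takel // size_tuple.
Qed.

(** The map [\1 - projv U] kills [U] but not a vector [x] outside [U]; [f] is this map followed by a
    coordinate that is nonzero at the image of [x]. *)
Lemma separating_functional U : (U != fullv)%VS ->
  exists2 f : 'Hom(vT, K^o), f != 0 & (U <= lker f)%VS.
Proof.
move=> Unf.
have /subvPn[x _ xU] : ~~ (fullv <= U)%VS.
  by apply: contra Unf => fU; rewrite eqEsubv subvf.
pose y := x - projv U x.
have y0 : y != 0.
  by apply: contra xU => /eqP/subr0_eq ->; apply: memv_proj.
have [i yi] : exists i, coord (vbasis fullv) i y != 0.
  apply/existsP; apply: contraR y0 => /existsPn yi0.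
  rewrite [y](coord_vbasis (memvf y)) big1 // => i _.
  by move/negPn/eqP: (yi0 i) => ->; rewrite scale0r.
pose c : 'Hom(vT, K^o) := linfun (coord (vbasis fullv) i : _ -> K^o).
exists (c \o (\1 - projv U))%VF.
  apply: contra yi => /eqP/lfunP/(_ x).
  by rewrite comp_lfunE add_lfunE opp_lfunE id_lfunE lfunE zero_lfunE => /eqP.
apply/subvP => u uU; rewrite memv_ker comp_lfunE add_lfunE opp_lfunE id_lfunE.
by rewrite projv_id // subrr linear0.
Qed.

Lemma dim_limg_vsval U (W : {vspace subvs_of U}) :
  \dim (linfun (@vsval _ _ U) @: W) = \dim W.
Proof.
apply/limg_dim_eq/eqP; rewrite -subv0; apply/subvP => x /memv_capP[_].
rewrite memv_ker lfunE /= memv0 => /eqP x0.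
by apply/eqP/subvs_inj; rewrite x0 linear0.
Qed.

(** The Kaplan forms and the functionals live on types [subvs_of U]; subspaces of [U] are pulled
    back there along the inclusion, which is injective with image [U]. *)
Lemma dim_preim_vsval U W : (W <= U)%VS ->
  \dim (linfun (@vsval _ _ U) @^-1: W) = \dim W.
Proof.
move=> WU; rewrite -dim_limg_vsval lpreimK //; apply/subvP => w wW.
have wU := subvP WU _ wW.
have -> : w = linfun (@vsval _ _ U) (vsproj U w) by rewrite lfunE /= vsprojK.
exact/memv_img/memvf.
Qed.

End Subspaces.

(** * Orthogonals and isotropic subspaces of a skew-symmetric form *)

Section Orthogonal.
Variables (K : fieldType) (vT : vectType K) (form : {skew_symmetric vT}).
Implicit Types U W P : {vspace vT}.

(** Each vector of [X] imposes one linear equation on [U], which lowers the dimension by at most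
    one. *)
Lemma dim_cap_orthov_span U (X : seq vT) :
  (\dim U <= \dim (U :&: orthov form <<X>>) + size X)%N.
Proof.
elim: X => [|u X IH]; first by rewrite span_nil orthov0 capvf addn0.
apply: (leq_trans IH); rewrite /= addnS -addSn leq_add2r.
have -> : (U :&: orthov form <<u :: X>> =
    (U :&: orthov form <<X>>) :&: orthov form <[u]>)%VS.
  rewrite -capvA; congr (U :&: _)%VS; apply/vspaceP => x.
  rewrite memv_cap span_cons mem_orthov_sym subv_add.
  by rewrite -!mem_orthov_sym andbC.
by have := leq_dim_orthov1 form u (U :&: orthov form <<X>>)%VS; lia.
Qed.

(** All of [U] is orthogonal to [W :&: orthov form U], so only its complement [W'] in [W] imposes
    equations on [U], and [\dim W'] of them suffice. *)
Lemma leq_dim_cap_orthov U W :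
  (\dim U + \dim (W :&: orthov form U)
    <= \dim (U :&: orthov form W) + \dim W)%N.
Proof.
set W' := (W :\: orthov form U)%VS.
have -> : (U :&: orthov form W = U :&: orthov form W')%VS.
  apply/vspaceP => x; rewrite !memv_cap; case xU: (x \in U) => //=.
  rewrite !(mem_orthov_sym form _ x) -(addv_diff_cap W (orthov form U)) subv_add.
  suff -> : (W :&: orthov form U <= orthov form <[x]>)%VS by rewrite andbT.
  rewrite orthov_sym -memvE; apply/mem_orthovP => w /memv_capP[_ wU].
  by apply/eqP; rewrite herm_eq0C; apply/eqP/(mem_orthovP wU).
have := dim_cap_orthov_span U (vbasis W').
rewrite (span_basis (vbasisP W')) size_tuple.
by have := dimv_cap_compl W (orthov form U); rewrite -/W'; lia.
Qed.

Lemma dim_cap_orthov U W :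
  (\dim (U :&: orthov form W) + \dim W
    = \dim U + \dim (W :&: orthov form U))%N.
Proof.
by have := leq_dim_cap_orthov U W; have := leq_dim_cap_orthov W U; lia.
Qed.

(** With the whole space as [U], the dimension formula computes [\dim (orthov form P)], which
    isotropy bounds below by [\dim P]. *)
Lemma form_rank_isotropic P : (P <= orthov form P)%VS ->
  (form_rank form <= 2 * (\dim {:vT} - \dim P))%N.
Proof.
move=> /dimvS isoP; have := dim_cap_orthov fullv P.
rewrite capfv /form_rank; have := dimvS (subvf P).
by have := dimvS (capvSr P (orthov form fullv)); lia.
Qed.

(** The kernel of the form is orthogonal to [P], hence contained in [P], and the estimates of
    [form_rank_isotropic] become equalities. *)
Lemma form_rank_lagrangian P : orthov form P = P ->
  form_rank form = (2 * (\dim {:vT} - \dim P))%N.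
Proof.
move=> lagP; have := dim_cap_orthov fullv P.
have -> : (P :&: orthov form fullv = orthov form fullv)%VS.
  apply/capv_idPr; rewrite -[X in (_ <= X)%VS]lagP; apply/subvP => x.
  by move=> /mem_orthovP rad_x; apply/mem_orthovP => v _; rewrite rad_x ?memvf.
by rewrite capfv lagP /form_rank; have := dimvS (subvf P); lia.
Qed.

(** Starting from 0, an isotropic [P] is enlarged by a vector of its orthogonal outside [P].
    Alternation keeps the sum isotropic, and the codimension, bounded by [n], drops each time. *)
Lemma lagrangian_ex : (forall v, form v v = 0) ->
  exists P, orthov form P = P.
Proof.
move=> alt.
suff ext n P : (P <= orthov form P)%VS -> (\dim {:vT} - \dim P <= n)%N ->
    exists P, orthov form P = P.
  by apply: (ext _ 0%VS _ (leqnn _)); apply: sub0v.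
elim: n P => [|n IH] P isoP dP.
  exists P; apply/eqP; rewrite eqEsubv isoP andbT.
  suff /eqP -> : P == fullv by apply: subvf.
  by rewrite eqEdim subvf /=; lia.
have [sP|/subvPn[v vP' vP]] := boolP (orthov form P <= P)%VS.
  by exists P; apply/eqP; rewrite eqEsubv sP.
apply: (IH (P + <[v]>)%VS).
  rewrite orthoDv !orthovD isoP orthov11 alt eqxx andbT /= [X in X && _]orthov_sym.
  by rewrite -!memvE vP'.
have : (\dim P < \dim (P + <[v]>))%N.
  rewrite (ltn_leqif (dimv_leqif_sup (addvSl _ _))) subv_add subvv /=.
  by rewrite -memvE.
lia.
Qed.

End Orthogonal.

(** * Generation by subspaces of the first layer, and Kaplan forms *)

Section Stratified.
Variables (K : fieldType) (g : lieAlgType K) (S : step2_stratification g).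
Implicit Types P : {vspace g}.
Local Notation V1 := (layer1 S).
Local Notation V2 := (layer2 S).
Local Notation dualV2 := ('Hom(subvs_of V2, K^o)).

Lemma bracketsvS (U U' W W' : {vspace g}) :
  (U <= U')%VS -> (W <= W')%VS -> (bracketsv U W <= bracketsv U' W')%VS.
Proof.
move=> /subvP sU /subvP sW; apply/bracketsvP => x y xU yW.
by rewrite memv_bracket ?sU ?sW.
Qed.

Lemma bracket_layer2r (x y : g) : y \in V2 -> bracket x y = 0.
Proof.
move=> yV2; have : x \in (V1 + V2)%VS by rewrite layers_full memvf.
case/memv_addP => x1 x1V [x2 x2V ->]; rewrite linearDl /=.
have := memv_bracket x1V yV2; rewrite bracket_layer12 memv0 => /eqP ->.
have := memv_bracket x2V yV2; rewrite bracket_layer22 memv0 => /eqP ->.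
by rewrite addr0.
Qed.

Lemma bracketsv_fullv : bracketsv (fullv : {vspace g}) fullv = V2.
Proof.
apply/eqP; rewrite eqEsubv -[X in _ && (X <= _)%VS](bracket_layer11 S).
rewrite bracketsvS ?subvf ?andbT //.
apply/bracketsvP => x y _ _.
have : x \in (V1 + V2)%VS by rewrite layers_full memvf.
case/memv_addP => x1 x1V [x2 x2V ->].
have : y \in (V1 + V2)%VS by rewrite layers_full memvf.
case/memv_addP => y1 y1V [y2 y2V ->].
rewrite linearDr linearDl /= !(bracket_layer2r _ y2V) addr0.
rewrite (bracketC x2) (bracket_layer2r _ x2V) oppr0 addr0.
by rewrite -bracket_layer11 memv_bracket.
Qed.

(** The second layer is central, so a bracket of two elements of the sum depends only on their
    components in [P]. *)
Lemma lie_subalgebra_add_bracketsv P :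
  (P <= V1)%VS -> lie_subalgebra (P + bracketsv P P)%VS.
Proof.
move=> PV1.
have DV2 : (bracketsv P P <= V2)%VS by rewrite -bracket_layer11 bracketsvS.
apply/bracketsvP => x y /memv_addP[x1 x1P [x2 x2D ->]].
case/memv_addP => y1 y1P [y2 y2D ->].
rewrite linearDr linearDl /= !(bracket_layer2r _ (subvP DV2 _ y2D)) addr0.
rewrite (bracketC x2) (bracket_layer2r _ (subvP DV2 _ x2D)) oppr0 addr0.
exact: subvP (addvSr _ _) _ (memv_bracket _ _).
Qed.

(** Testing the hull against the subalgebra [P + bracketsv P P] puts [V2] inside this sum; the
    component in [P] of an element of [V2] vanishes because the layers meet in 0. *)
Lemma sub_lie_hullP P : (P <= V1)%VS ->
  ([set x | x \in bracketsv fullv fullv] `<=` lie_hull P)%classic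
    <-> bracketsv P P = V2.
Proof.
move=> PV1; rewrite bracketsv_fullv.
have DV2 : (bracketsv P P <= V2)%VS by rewrite -bracket_layer11 bracketsvS.
split=> [hull|DE x /= xV2 L [] /= subL PL]; last first.
  by apply: (subvP subL); apply: (subvP (bracketsvS PL PL)); rewrite DE.
apply/eqP; rewrite eqEsubv DV2; apply/subvP => x xV2.
have := hull x xV2 _ (conj (lie_subalgebra_add_bracketsv PV1) (addvSl _ _)).
move=> /= /memv_addP[p pP [d dD xE]].
suff p0 : p = 0 by rewrite xE p0 add0r.
apply/eqP; rewrite -memv0 -(directv_addP (layers_direct S)) memv_cap.
rewrite (subvP PV1) //= -(addrK d p) -xE memvB //.
exact: subvP DV2 _ dD.
Qed.

(** Over a field of characteristic 2 this does not follow from skew-symmetry; it is the condition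
    asked by [lagrangian_ex]. *)
Lemma kaplan_alternating (mu : dualV2) v : kaplan mu v v = 0.
Proof. by rewrite /kaplan bracketvv !linear0. Qed.

Lemma metivier_order_le (mu : dualV2) : mu != 0 ->
  (metivier_order S <= form_rank (kaplan mu))%N.
Proof.
move=> mu0; rewrite /metivier_order; case: ex_minnP => r _; apply.
by apply/asboolP; exists mu.
Qed.

Lemma metivier_orderP :
  exists2 mu : dualV2, mu != 0 & form_rank (kaplan mu) = metivier_order S.
Proof. by rewrite /metivier_order; case: ex_minnP => r /asboolP. Qed.

Lemma isotropic_kaplanP (mu : dualV2) P : (P <= V1)%VS ->
  reflect {in P &, forall x y, mu (vsproj V2 (bracket x y)) = 0}
    (linfun (@vsval _ _ V1) @^-1: P
      <= orthov (kaplan mu) (linfun (@vsval _ _ V1) @^-1: P))%VS.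
Proof.
move=> PV1; apply: (iffP orthovP) => iso x y.
  move=> xP yP; have := iso (vsproj V1 x) (vsproj V1 y).
  rewrite -!memv_preim !lfunE /= /kaplan !vsprojK ?(subvP PV1) //.
  by apply.
rewrite -!memv_preim !lfunE /=; exact: iso.
Qed.

Lemma bracketsv_neq_layer2P P : (P <= V1)%VS ->
  bracketsv P P != V2 <-> exists2 mu : dualV2, mu != 0 &
    (linfun (@vsval _ _ V1) @^-1: P
      <= orthov (kaplan mu) (linfun (@vsval _ _ V1) @^-1: P))%VS.
Proof.
move=> PV1.
have DV2 : (bracketsv P P <= V2)%VS by rewrite -bracket_layer11 bracketsvS.
pose iota := linfun (@vsval _ _ V2).
split=> [DnV2|[mu mu0 /(isotropic_kaplanP _ PV1) iso]].
  have : (iota @^-1: bracketsv P P)%VS != fullv.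
    apply: contra DnV2 => /eqP Df; rewrite eqEdim DV2 -(dim_preim_vsval DV2).
    by rewrite -/iota Df dimvf leqnn.
  case/separating_functional => mu mu0 /subvP muD; exists mu => //.
  apply/isotropic_kaplanP => // x y xP yP.
  have xyD := memv_bracket xP yP.
  have := muD (vsproj V2 (bracket x y)).
  rewrite -memv_preim lfunE /= vsprojK ?(subvP DV2) // memv_ker => /(_ xyD).
  by move/eqP.
apply: contra mu0 => /eqP DE; apply/eqP/lfunP => z; rewrite zero_lfunE.
(* All brackets of [P] lie in the kernel of [mu], carried into [g] by the inclusion; if they span
   [V2], this kernel is everything. *)
suff /bracketsvP/subvP/(_ (vsval z)) : {in P &, forall x y,
    bracket x y \in iota @: lker mu}%VS.
  rewrite DE subvsP => /(_ isT)/memv_imgP[w]; rewrite memv_ker lfunE /=.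
  by move=> /eqP muw /subvs_inj ->.
move=> x y xP yP; apply/memv_imgP; exists (vsproj V2 (bracket x y)).
  by rewrite memv_ker iso.
by rewrite lfunE /= vsprojK // (subvP DV2) ?memv_bracket.
Qed.

Lemma hypergeneratedP k : hypergenerated S k <-> (2 * k < metivier_order S)%N.
Proof.
have dV1 : \dim {:subvs_of V1} = \dim V1 by rewrite dimvf.
split=> [hyp|kS P PV1 dP].
  rewrite ltnNge; apply/negP => leSk.
  have [mu mu0 rk] := metivier_orderP.
  have [Q lagQ] := lagrangian_ex (kaplan_alternating mu).
  have := form_rank_lagrangian lagQ; rewrite rk dV1 => ordE.
  (* By [ordE] the codimension of [Q] is half the order, hence at most [k]. A subspace of an
     isotropic space is isotropic, so [Q] can be cut down to the required dimension, which is 0 when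
     [k] exceeds [\dim V1]. *)
  have [W WQ dW] : exists2 W, (W <= Q)%VS & \dim W = (\dim V1 - k)%N.
    by apply: subv_dim_ex; move: (dimvS (subvf Q)); rewrite dV1; lia.
  pose P := (linfun (@vsval _ _ V1) @: W)%VS.
  have PV1 : (P <= V1)%VS.
    by apply/subvP => _ /memv_imgP[w _ ->]; rewrite lfunE subvsP.
  have dP : \dim P = (\dim V1 - k)%N by rewrite dim_limg_vsval.
  have /(sub_lie_hullP PV1)/eqP := hyp P PV1 dP.
  apply/negP/(bracketsv_neq_layer2P PV1); exists mu => //.
  apply/isotropic_kaplanP => // _ _ /memv_imgP[x xW ->] /memv_imgP[y yW ->].
  rewrite !lfunE /=; have /orthovP : (Q <= orthov (kaplan mu) Q)%VS.
    by rewrite lagQ.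
  by apply; apply: (subvP WQ).
apply/(sub_lie_hullP PV1)/eqP; apply: contraLR kS.
case/(bracketsv_neq_layer2P PV1) => mu mu0 /form_rank_isotropic.
rewrite dim_preim_vsval // dP dV1 -leqNgt => rk.
(* With truncated subtraction, the codimension of [P] is the minimum of [k] and [\dim V1], hence at
   most [k]. *)
apply: leq_trans (metivier_order_le mu0) (leq_trans rk _); lia.
Qed.

End Stratified.

Theorem proposition3p8 (R : realType) (g : lieAlgType R)
    (S : step2_stratification g) (k : nat) :
  hypergenerated S k <-> (2 * k < metivier_order S)%N.
Proof. exact: hypergeneratedP. Qed.
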